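(* Let $d\ge1$ be an integer. Let $\Lambda_d^{(1)}$ be the $\mathbb{Q}$-vector space of symmetric polynomials in $x_1,\dots,x_d$ whose degree in each variable does not exceed $1$, regarded as an $\mathfrak{sl}_2$-module via $$\mathfrak{e}_+\mapsto\sum_{k=1}^d\Big(-x_k^2\frac{\partial}{\partial x_k}+x_k\Big),\qquad \mathfrak{h}\mapsto2\sum_{k=1}^d x_k\frac{\partial}{\partial x_k}-d,\qquad \mathfrak{e}_-\mapsto\sum_{k=1}^d\frac{\partial}{\partial x_k}.$$ Put $$w_0=e_0=1,\qquad w_i=\frac{i!}{(d-(i-1))(d-(i-2))\cdots d}\,e_i,\quad i=1,\dots,d,$$ where $e_i$ are the elementary symmetric polynomials in $x_1,\dots,x_d$. Then $\Lambda_d^{(1)}$ is a realization of the standard finite-dimensional $\mathfrak{sl}_2$-module $V_d$ with basis $w_0,\dots,w_d$; that is, $w_0,\dots,w_d$ is a basis of $\Lambda_d^{(1)}$ and the linear map $V_d\to\Lambda_d^{(1)}$, $v_i\mapsto w_i$, is an isomorphism of $\mathfrak{sl}_2$-modules.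
   Context: $\mathfrak{sl}_2$ has basis $\mathfrak{e}_-,\mathfrak{h},\mathfrak{e}_+$ with $[\mathfrak{h},\mathfrak{e}_+]=2\mathfrak{e}_+$, $[\mathfrak{h},\mathfrak{e}_-]=-2\mathfrak{e}_-$, $[\mathfrak{e}_+,\mathfrak{e}_-]=\mathfrak{h}$; an $\mathfrak{sl}_2$-module is a $\mathbb{Q}$-vector space with three endomorphisms (the images of these basis elements) satisfying these relations. The operators above preserve $\Lambda_d^{(1)}$ and satisfy the relations. $V_d$ denotes the standard irreducible $\mathfrak{sl}_2$-module with basis $v_0,\dots,v_d$ and action $\mathfrak{e}_+v_i=(d-i)v_{i+1}$, $\mathfrak{h}v_i=(2i-d)v_i$, $\mathfrak{e}_-v_i=i\,v_{i-1}$ (with $v_{-1}=v_{d+1}=0$). *)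

(* Defs.v *)
From HB Require Import structures.
From mathcomp Require Import all_boot all_order all_algebra.
From mathcomp Require Import perm.
From mathcomp Require Import mpoly.
From mathcomp Require Import ring.

Set Implicit Arguments.
Unset Strict Implicit.
Unset Printing Implicit Defensive.

Import Order.TTheory GRing.Theory Num.Theory.
Local Open Scope ring_scope.

Record sl2Module := Sl2Module {
  sl2_sort :> lmodType rat;
  sl2_ep : {linear sl2_sort -> sl2_sort};
  sl2_h : {linear sl2_sort -> sl2_sort};
  sl2_em : {linear sl2_sort -> sl2_sort};
  sl2_rel_h_ep : forall v,
    sl2_h (sl2_ep v) - sl2_ep (sl2_h v) = 2%:R *: sl2_ep v;
  sl2_rel_h_em : forall v,
    sl2_h (sl2_em v) - sl2_em (sl2_h v) = - (2%:R *: sl2_em v);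
  sl2_rel_ep_em : forall v,
    sl2_ep (sl2_em v) - sl2_em (sl2_ep v) = sl2_h v
}.

Arguments sl2_ep {s}.
Arguments sl2_h {s}.
Arguments sl2_em {s}.

Definition sl2_iso (V W : sl2Module) (f : {linear V -> W}) : Prop :=
  [/\ bijective f,
      forall v, f (sl2_ep v) = sl2_ep (f v),
      forall v, f (sl2_h v) = sl2_h (f v)
    & forall v, f (sl2_em v) = sl2_em (f v)].

Definition is_basis (V : lmodType rat) (n : nat) (b : 'I_n -> V) : Prop :=
  (forall c : 'I_n -> rat, \sum_(i < n) c i *: b i = 0 -> forall i, c i = 0) /\
  (forall v : V, exists c : 'I_n -> rat, v = \sum_(i < n) c i *: b i).

Section StandardModule.
Variable d : nat.

(* The operators act on row vectors by right multiplication, so row i of each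
   matrix holds the image of v_i; rows i = d of std_ep and i = 0 of std_em
   vanish, which encodes v_{d+1} = v_{-1} = 0. *)
Definition std_v (i : 'I_d.+1) : 'rV[rat]_d.+1 := delta_mx 0 i.

Definition std_ep_mx : 'M[rat]_d.+1 :=
  \matrix_(i, j) (if j == i.+1 :> nat then d%:R - i%:R else 0).
Definition std_h_mx : 'M[rat]_d.+1 :=
  \matrix_(i, j) (if j == i :> nat then 2%:R * i%:R - d%:R else 0).
Definition std_em_mx : 'M[rat]_d.+1 :=
  \matrix_(i, j) (if j.+1 == i :> nat then i%:R else 0).

Definition std_ep (v : 'rV[rat]_d.+1) := v *m std_ep_mx.
Definition std_h (v : 'rV[rat]_d.+1) := v *m std_h_mx.
Definition std_em (v : 'rV[rat]_d.+1) := v *m std_em_mx.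

Fact std_ep_linear : linear std_ep.
Proof. by move=> a u v; rewrite /std_ep mulmxDl scalemxAl. Qed.
Fact std_h_linear : linear std_h.
Proof. by move=> a u v; rewrite /std_h mulmxDl scalemxAl. Qed.
Fact std_em_linear : linear std_em.
Proof. by move=> a u v; rewrite /std_em mulmxDl scalemxAl. Qed.
HB.instance Definition _ := GRing.isLinear.Build _ _ _ _ std_ep std_ep_linear.
HB.instance Definition _ := GRing.isLinear.Build _ _ _ _ std_h std_h_linear.
HB.instance Definition _ := GRing.isLinear.Build _ _ _ _ std_em std_em_linear.

Lemma std_ep_v (i : 'I_d.+1) (lt_id : (i.+1 < d.+1)%N) :
  std_ep (std_v i) = (d%:R - i%:R) *: std_v (Ordinal lt_id).
Proof.
apply/rowP=> j; rewrite /std_ep -rowE !mxE eqxx /= -val_eqE /=.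
by case: eqP; rewrite ?mulr1 ?mulr0.
Qed.

Lemma std_ep_vd : std_ep (std_v ord_max) = 0.
Proof. by apply/rowP=> j; rewrite /std_ep -rowE !mxE /= subrr if_same. Qed.

Lemma std_h_v (i : 'I_d.+1) :
  std_h (std_v i) = (2%:R * i%:R - d%:R) *: std_v i.
Proof.
apply/rowP=> j; rewrite /std_h -rowE !mxE eqxx /= -val_eqE /=.
by case: eqP; rewrite ?mulr1 ?mulr0.
Qed.

Lemma std_em_v (i j : 'I_d.+1) (eq_i : i = j.+1 :> nat) :
  std_em (std_v i) = i%:R *: std_v j.
Proof.
apply/rowP=> k; rewrite /std_em -rowE !mxE eqxx /= -val_eqE /= eq_i eqSS.
by case: eqP; rewrite ?mulr1 ?mulr0.
Qed.

Lemma std_em_v0 : std_em (std_v ord0) = 0.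
Proof. by apply/rowP=> j; rewrite /std_em -rowE !mxE. Qed.

Lemma std_ext (f g : {linear 'rV[rat]_d.+1 -> 'rV[rat]_d.+1}) :
  (forall i, f (std_v i) = g (std_v i)) -> f =1 g.
Proof.
move=> fg v; rewrite (row_sum_delta v) !linear_sum.
by apply: eq_bigr => i _; rewrite !linearZ fg.
Qed.

Lemma std_v_basis : is_basis std_v.
Proof.
split=> [c c0 i | v]; last by exists (v 0); rewrite -row_sum_delta.
have /rowP/(_ i) := c0; rewrite summxE (bigD1 i) //= big1 => [|j ne_ji].
  by rewrite !mxE !eqxx mulr1 addr0.
by rewrite !mxE (eq_sym i) (negbTE ne_ji) andbF mulr0.
Qed.

Fact std_rel_h_ep v : std_h (std_ep v) - std_ep (std_h v) = 2%:R *: std_ep v.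
Proof.
rewrite {1}/std_h /std_ep /std_h -!mulmxA -mulmxBr scalemxAr.
congr (_ *m _); apply/matrixP=> i j; rewrite !mxE.
under eq_bigr do rewrite !mxE.
under [X in _ - X]eq_bigr do rewrite !mxE.
rewrite (bigD1 j) //= eqxx big1 ?addr0; last first.
  by move=> k; rewrite -val_eqE /= eq_sym => /negbTE ->; rewrite mulr0.
rewrite (bigD1 i) //= eqxx big1 ?addr0; last first.
  by move=> k; rewrite -val_eqE /= => /negbTE ->; rewrite mul0r.
case: eqP => [->|_]; last by rewrite !(mul0r, mulr0) subrr.
by rewrite -[i.+1]addn1 natrD; ring.
Qed.

Fact std_rel_h_em v :
  std_h (std_em v) - std_em (std_h v) = - (2%:R *: std_em v).
Proof.
rewrite {1}/std_h /std_em /std_h -!mulmxA -mulmxBr scalemxAr -[RHS]mulmxN.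
congr (_ *m _); apply/matrixP=> i j; rewrite !mxE.
under eq_bigr do rewrite !mxE.
under [X in _ - X]eq_bigr do rewrite !mxE.
rewrite (bigD1 j) //= eqxx big1 ?addr0; last first.
  by move=> k; rewrite -val_eqE /= eq_sym => /negbTE ->; rewrite mulr0.
rewrite (bigD1 i) //= eqxx big1 ?addr0; last first.
  by move=> k; rewrite -val_eqE /= => /negbTE ->; rewrite mul0r.
case: eqP => [<-|_]; last by rewrite !(mul0r, mulr0) subrr oppr0.
by rewrite -[j.+1]addn1 natrD; ring.
Qed.

Fact std_rel_ep_em v : std_ep (std_em v) - std_em (std_ep v) = std_h v.
Proof.
suff /(_ v): (std_ep \o std_em) \- (std_em \o std_ep) =1 std_h.
  by [].
apply: std_ext => i /=; rewrite std_h_v.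
have -> : std_ep (std_em (std_v i)) = (i%:R * (d%:R - i%:R + 1)) *: std_v i.
  case: i => [[|i] lti].
    have -> : Ordinal lti = ord0 by apply: val_inj.
    by rewrite std_em_v0 /std_ep mul0mx mul0r scale0r.
  have lti' : (i < d.+1)%N by apply: ltnW.
  rewrite (@std_em_v _ (Ordinal lti')) // linearZ /= (@std_ep_v (Ordinal lti')).
  rewrite scalerA; congr (_ *: std_v _).
  by rewrite /= -[i.+1]addn1 natrD; ring.
have -> : std_em (std_ep (std_v i)) = ((i%:R + 1) * (d%:R - i%:R)) *: std_v i.
  case: (ltnP i d) => [ltid | led].
    rewrite (@std_ep_v _ ltid) linearZ /= (@std_em_v _ i) // scalerA /=.
    by rewrite -[i.+1]addn1 natrD mulrC.
  have -> : i = ord_max by apply/val_inj/eqP; rewrite eqn_leq -ltnS ltn_ord.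
  by rewrite std_ep_vd /std_em mul0mx subrr mulr0 scale0r.
by rewrite -scalerBl; congr (_ *: _); ring.
Qed.

Definition Vstd : sl2Module :=
  @Sl2Module 'rV[rat]_d.+1 std_ep std_h std_em
    std_rel_h_ep std_rel_h_em std_rel_ep_em.

End StandardModule.

Section SymmetricModule.
Variable d : nat.
Implicit Types (p q : {mpoly rat[d]}) (k l : 'I_d).

Definition degvar k p : nat := \max_(m <- msupp p) m k.

Definition Lambda_pred : {pred {mpoly rat[d]}} :=
  [pred p | (p \is symmetric) && [forall k, degvar k p <= 1]%N].

Definition pol_ep p : {mpoly rat[d]} :=
  \sum_(k < d) (- ('X_k ^+ 2 * p^`M(k)) + 'X_k * p).
Definition pol_h p : {mpoly rat[d]} :=
  2%:R *: (\sum_(k < d) 'X_k * p^`M(k)) - d%:R *: p.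
Definition pol_em p : {mpoly rat[d]} := \sum_(k < d) p^`M(k).

Lemma degvarP p :
  reflect (forall m k, p@_m != 0 -> (m k <= 1)%N) [forall k, degvar k p <= 1]%N.
Proof.
apply: (iffP forallP) => [le1 m k | le1 k].
  rewrite -mcoeff_msupp => m_p; apply: leq_trans (le1 k).
  by rewrite /degvar (big_rem m) //= leq_maxl.
rewrite /degvar big_seq; elim/big_ind: _ => // [x y ? ?|m m_p].
  by rewrite geq_max; apply/andP.
by apply: le1; rewrite -mcoeff_msupp.
Qed.

Fact Lambda_submod_closed : submod_closed Lambda_pred.
Proof.
split=> [|a p q /andP[symp degp] /andP[symq degq]]; rewrite inE.
  by rewrite rpred0; apply/degvarP => m k; rewrite mcoeff0 eqxx.
rewrite rpredD ?rpredZ //=; apply/degvarP => m k.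
rewrite mcoeffD mcoeffZ => nz.
have [p0|p0] := eqVneq p@_m 0; last exact: (degvarP _ degp).
by apply: (degvarP _ degq); rewrite p0 mulr0 add0r in nz.
Qed.
HB.instance Definition _ :=
  GRing.isSubmodClosed.Build rat {mpoly rat[d]} Lambda_pred Lambda_submod_closed.

Record Lambda_type := LambdaType {
  Lambda_val :> {mpoly rat[d]};
  _ : Lambda_val \in Lambda_pred
}.
HB.instance Definition _ := [isSub for Lambda_val].
HB.instance Definition _ := [Choice of Lambda_type by <:].
HB.instance Definition _ := [SubChoice_isSubLmodule of Lambda_type by <:].

Fact pol_ep_linear : linear pol_ep.
Proof.
move=> a p q; rewrite /pol_ep scaler_sumr -big_split /=; apply: eq_bigr => k _.
by rewrite mderivD mderivZ -!mul_mpolyC; ring.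
Qed.
Fact pol_em_linear : linear pol_em.
Proof.
move=> a p q; rewrite /pol_em scaler_sumr -big_split /=; apply: eq_bigr => k _.
by rewrite mderivD mderivZ.
Qed.
Fact pol_h_linear : linear pol_h.
Proof.
move=> a p q; rewrite /pol_h.
have -> : \sum_(k < d) 'X_k * (a *: p + q)^`M(k)
        = a *: (\sum_(k < d) 'X_k * p^`M(k)) + \sum_(k < d) 'X_k * q^`M(k).
  rewrite scaler_sumr -big_split /=; apply: eq_bigr => k _.
  by rewrite mderivD mderivZ -!mul_mpolyC; ring.
by rewrite -!mul_mpolyC; ring.
Qed.

Lemma pol_hE p : pol_h p = \sum_(k < d) (2%:R *: ('X_k * p^`M(k)) - p).
Proof.
rewrite /pol_h big_split /= -scaler_sumr sumrN sumr_const card_ord.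
by rewrite !scaler_nat.
Qed.

Lemma mderivXU k l : ('X_k : {mpoly rat[d]})^`M(l) = (k == l)%:R.
Proof.
rewrite mderivX mnm1E; case: eqP => [->|_]; last by rewrite scale0r.
by rewrite scale1r -{1}[U_(l)%MM]addm0 addmC addmK mpolyX0.
Qed.

Lemma comm_sum (A B C : 'I_d -> {mpoly rat[d]} -> {mpoly rat[d]}) p :
  (forall k, linear (A k)) -> (forall k, linear (B k)) ->
  (forall k l, A k (B l p) - B l (A k p) = if k == l then C k p else 0) ->
  \sum_k A k (\sum_l B l p) - \sum_k B k (\sum_l A l p) = \sum_k C k p.
Proof.
move=> linA linB ABC.
have addE (f : {mpoly rat[d]} -> {mpoly rat[d]}) (F : 'I_d -> {mpoly rat[d]}) :
    linear f -> f (\sum_k F k) = \sum_k f (F k).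
  move=> linf; have fD x y : f (x + y) = f x + f y.
    by have := linf 1 x y; rewrite !scale1r.
  by apply: (big_morph f fD); apply: (addrI (f 0)); rewrite -fD !addr0.
under eq_bigr do rewrite addE //.
under [X in _ - X]eq_bigr do rewrite addE //.
rewrite [X in _ - X]exchange_big -sumrB; apply: eq_bigr => k _.
rewrite -sumrB; under eq_bigr do rewrite ABC.
rewrite (bigD1 k) //= eqxx big1 ?addr0 // => l.
by rewrite eq_sym => /negbTE ->.
Qed.


Fact pol_rel_h_ep p : pol_h (pol_ep p) - pol_ep (pol_h p) = 2%:R *: pol_ep p.
Proof.
rewrite /pol_ep scaler_sumr !pol_hE.
pose A k p : {mpoly rat[d]} := 2%:R *: ('X_k * p^`M(k)) - p.
pose B k p : {mpoly rat[d]} := - ('X_k ^+ 2 * p^`M(k)) + 'X_k * p.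
apply: (@comm_sum A B (fun k p => 2%:R *: B k p)).
- by move=> k a q r; rewrite /A mderivD mderivZ -!mul_mpolyC; ring.
- by move=> k a q r; rewrite /B mderivD mderivZ -!mul_mpolyC; ring.
move=> k l; rewrite /A /B !(mderivZ, mderivD, mderivN, mderivM, expr2, mderivXU).
rewrite (mderiv_comm l k) [l == k]eq_sym.
by case: eqVneq => [->|_] /=; rewrite -?mul_mpolyC ?mpolyC_nat; ring.
Qed.

Fact pol_rel_h_em p :
  pol_h (pol_em p) - pol_em (pol_h p) = - (2%:R *: pol_em p).
Proof.
rewrite /pol_em scaler_sumr -[RHS]sumrN !pol_hE.
pose A k p : {mpoly rat[d]} := 2%:R *: ('X_k * p^`M(k)) - p.
apply: (@comm_sum A (fun k p => p^`M(k)) (fun k p => - (2%:R *: p^`M(k)))).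
- by move=> k a q r; rewrite /A mderivD mderivZ -!mul_mpolyC; ring.
- by move=> k a q r; rewrite mderivD mderivZ.
move=> k l; rewrite /A !(mderivZ, mderivD, mderivN, mderivM, mderivXU).
rewrite (mderiv_comm l k).
by case: eqVneq => [->|_] /=; rewrite -?mul_mpolyC ?mpolyC_nat; ring.
Qed.

Fact pol_rel_ep_em p : pol_ep (pol_em p) - pol_em (pol_ep p) = pol_h p.
Proof.
rewrite /pol_ep /pol_em pol_hE.
pose B k p : {mpoly rat[d]} := - ('X_k ^+ 2 * p^`M(k)) + 'X_k * p.
apply: (@comm_sum B (fun k p => p^`M(k))
          (fun k p => 2%:R *: ('X_k * p^`M(k)) - p)).
- by move=> k a q r; rewrite /B mderivD mderivZ -!mul_mpolyC; ring.
- by move=> k a q r; rewrite mderivD mderivZ.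
move=> k l; rewrite /B !(mderivZ, mderivD, mderivN, mderivM, expr2, mderivXU).
rewrite (mderiv_comm l k).
by case: eqVneq => [->|_] /=; rewrite -?mul_mpolyC ?mpolyC_nat; ring.
Qed.

Lemma msym_XU (s : 'S_d) k : msym s ('X_k : {mpoly rat[d]}) = 'X_(s k).
Proof.
apply/mpolyP => m; rewrite mcoeff_sym !mcoeffX; congr ((_ : bool)%:R).
apply/eqP/eqP => [/mnmP eqm | <-]; apply/mnmP => i.
  by have := eqm ((s^-1)%g i); rewrite mnmE permKV !mnm1E -(inj_eq (@perm_inj _ s)) permKV.
by rewrite mnmE !mnm1E (inj_eq (@perm_inj _ s)).
Qed.

Lemma msym_mderiv (s : 'S_d) k p : msym s p^`M(k) = (msym s p)^`M(s k).
Proof.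
apply/mpolyP => m; rewrite mcoeff_mderiv !mcoeff_sym mcoeff_mderiv mnmE.
congr (p@_ _ *+ _); apply/mnmP => i.
by rewrite !(mnmE, mnm1E) (inj_eq (@perm_inj _ s)).
Qed.

Lemma sym_sum (A : 'I_d -> {mpoly rat[d]}) :
  (forall s k, msym s (A k) = A (s k)) -> \sum_k A k \is symmetric.
Proof.
move=> symA; apply/issymP => s; rewrite raddf_sum /=.
by rewrite [RHS](reindex_inj (@perm_inj _ s)); apply: eq_bigr => k _.
Qed.

Lemma Lambda_expand (A : 'I_d -> {mpoly rat[d]} -> {mpoly rat[d]}) p :
  (forall k, linear (A k)) ->
  (forall s k q, msym s (A k q) = A (s k) (msym s q)) ->
  (forall k (m u : 'X_{1..d}) l, (forall j, m j <= 1)%N ->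
     (A k 'X_[m])@_u != 0 -> (u l <= 1)%N) ->
  p \in Lambda_pred -> \sum_k A k p \in Lambda_pred.
Proof.
move=> linA symA degA /andP[symp degp]; rewrite inE; apply/andP; split.
  by apply: sym_sum => s k; rewrite symA (issymP _ symp).
apply/degvarP => m l; apply: contraR => gt1; rewrite raddf_sum /=.
apply/eqP/big1 => k _.
pose Alin := GRing.isLinear.Build _ _ _ _ (A k) (linA k).
pose F : {linear {mpoly rat[d]} -> {mpoly rat[d]}} := HB.pack (A k) Alin.
rewrite -[A k]/(F : _ -> _) (mpolyE p) linear_sum raddf_sum.
rewrite big_seq; apply: big1 => u up; rewrite linearZ /= mcoeffZ.
have [-> | nz] := eqVneq (A k 'X_[u])@_m 0; first by rewrite mulr0.
case/negP: gt1; apply: (degA k u) nz => j.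
by apply: (degvarP _ degp); rewrite -mcoeff_msupp.
Qed.

Fact pol_ep_Lambda p : p \in Lambda_pred -> pol_ep p \in Lambda_pred.
Proof.
apply: (@Lambda_expand (fun k p => - ('X_k ^+ 2 * p^`M(k)) + 'X_k * p)) => [k a q r|s k q|k m u l le1].
- by rewrite mderivD mderivZ -!mul_mpolyC; ring.
- by rewrite msymD msymN !msymM !msym_XU msym_mderiv.
rewrite mderivX -scalerAr mpolyXn -!mpolyXD mcoeffD mcoeffN mcoeffZ !mcoeffX.
have := le1 k; rewrite leq_eqVlt ltnS leqn0 => /orP[]/eqP mk; rewrite mk.
  have -> : (U_(k) *+ 2 + (m - U_(k)) = U_(k) + m)%MM.
    apply/mnmP => j; rewrite !mnmE; case: eqP => [<-|_]; rewrite ?mk ?subn0 //.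
  by rewrite mul1r addNr eqxx.
rewrite mul0r oppr0 add0r; case: (_ =P u) => [<-|_] //= _.
by rewrite mnmDE mnm1E; case: (k =P l) => [<-|_]; rewrite ?mk ?add0n /=.
Qed.

Fact pol_em_Lambda p : p \in Lambda_pred -> pol_em p \in Lambda_pred.
Proof.
apply: (@Lambda_expand (fun k p => p^`M(k))) => [k a q r|s k q|k m u l le1].
- by rewrite mderivD mderivZ.
- by rewrite msym_mderiv.
rewrite mderivX mcoeffZ mcoeffX; case: (_ =P u) => [<- _|_].
  by rewrite mnmBE (leq_trans (leq_subr _ _)).
by rewrite mulr0 eqxx.
Qed.

Fact pol_h_Lambda p : p \in Lambda_pred -> pol_h p \in Lambda_pred.
Proof.
move=> Lp; rewrite /pol_h rpredB ?rpredZ //.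
apply: (@Lambda_expand (fun k p => 'X_k * p^`M(k))) Lp => [k a q r|s k q|k m u l le1].
- by rewrite mderivD mderivZ -!mul_mpolyC; ring.
- by rewrite msymM msym_XU msym_mderiv.
rewrite mderivX -scalerAr -mpolyXD mcoeffZ mcoeffX.
case: (posnP (m k)) => [->|mk]; first by rewrite mul0r eqxx.
rewrite addmC submK ?lep1mP -?lt0n //.
by case: (_ =P u) => [<- _|_]; rewrite ?mulr0 ?eqxx.
Qed.

Definition Lambda_ep (p : Lambda_type) : Lambda_type :=
  LambdaType (pol_ep_Lambda (valP p)).
Definition Lambda_h (p : Lambda_type) : Lambda_type :=
  LambdaType (pol_h_Lambda (valP p)).
Definition Lambda_em (p : Lambda_type) : Lambda_type :=
  LambdaType (pol_em_Lambda (valP p)).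

Fact Lambda_ep_linear : linear Lambda_ep.
Proof. by move=> a p q; apply: val_inj; rewrite /= pol_ep_linear. Qed.
Fact Lambda_h_linear : linear Lambda_h.
Proof. by move=> a p q; apply: val_inj; rewrite /= pol_h_linear. Qed.
Fact Lambda_em_linear : linear Lambda_em.
Proof. by move=> a p q; apply: val_inj; rewrite /= pol_em_linear. Qed.
HB.instance Definition _ :=
  GRing.isLinear.Build _ _ _ _ Lambda_ep Lambda_ep_linear.
HB.instance Definition _ :=
  GRing.isLinear.Build _ _ _ _ Lambda_h Lambda_h_linear.
HB.instance Definition _ :=
  GRing.isLinear.Build _ _ _ _ Lambda_em Lambda_em_linear.

Fact Lambda_rel_h_ep (p : Lambda_type) :
  Lambda_h (Lambda_ep p) - Lambda_ep (Lambda_h p) = 2%:R *: Lambda_ep p.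
Proof. by apply: val_inj; rewrite /= pol_rel_h_ep. Qed.
Fact Lambda_rel_h_em (p : Lambda_type) :
  Lambda_h (Lambda_em p) - Lambda_em (Lambda_h p) = - (2%:R *: Lambda_em p).
Proof. by apply: val_inj; rewrite /= pol_rel_h_em. Qed.
Fact Lambda_rel_ep_em (p : Lambda_type) :
  Lambda_ep (Lambda_em p) - Lambda_em (Lambda_ep p) = Lambda_h p.
Proof. by apply: val_inj; rewrite /= pol_rel_ep_em. Qed.

Definition Lambda : sl2Module :=
  @Sl2Module Lambda_type Lambda_ep Lambda_h Lambda_em
    Lambda_rel_h_ep Lambda_rel_h_em Lambda_rel_ep_em.

Fact mesym_Lambda i : mesym d rat i \in Lambda_pred.
Proof.
rewrite inE mesym_sym; apply/degvarP => m k.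
by rewrite -mcoeff_msupp mem_msupp_mesym => /andP[_ /forallP].
Qed.

Definition Lambda_e (i : nat) : Lambda := LambdaType (mesym_Lambda i).

(* The denominator is the product of the i factors d, d - 1, .., d - (i - 1);
   it is empty for i = 0. *)
Definition Lambda_w (i : 'I_d.+1) : Lambda :=
  (i`!%:R / \prod_(j < i) (d%:R - j%:R)) *: Lambda_e i.

Lemma Lambda_w0 : val (Lambda_w ord0) = 1.
Proof. by rewrite /= big_ord0 mesym0E divr1 scale1r. Qed.

End SymmetricModule.

(* Main.v *)
(* A polynomial in Lambda is determined by its coefficients on the squarefree
   monomials, and by symmetry such a coefficient depends only on the degree of
   the monomial; hence e_0, .., e_d is a basis. Reading off squarefree
   coefficients also gives e_- e_(i+1) = (d - i) e_i and
   e_+ e_i = (i + 1) e_(i+1), which the normalization of w_i turns into the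
   action on V_d. The action of h follows from h = [e_+, e_-]. *)

Require Import Defs.
From HB Require Import structures.
From mathcomp Require Import all_boot all_order all_algebra.
From mathcomp Require Import perm mpoly.

Set Implicit Arguments.
Unset Strict Implicit.
Unset Printing Implicit Defensive.

Import Order.TTheory GRing.Theory Num.Theory.
Local Open Scope ring_scope.

(** * Squarefree monomials and their orbits under the symmetric group *)

Lemma mcoeffXUM (R : nzRingType) n (k : 'I_n) (p : {mpoly R[n]}) m :
  ('X_k * p)@_m = if (0 < m k)%N then p@_(m - U_(k)) else 0.
Proof.
rewrite -commr_mpolyX; case: posnP => [mk0|mk_gt0].
  rewrite [p]mpolyE mulr_suml raddf_sum big1 //= => u _.
  rewrite -scalerAl -mpolyXD mcoeffZ mcoeffX; case: eqP => [um|]; last by rewrite mulr0.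
  by move: mk0; rewrite -um mnmDE mnm1E eqxx addn1.
by rewrite -{1}[m](@submK _ U_(k)) ?lep1mP -?lt0n // addmC mcoeffMX.
Qed.

Lemma mechar_mesym1 n (h : {set 'I_n}) i : mechar i (mesym1 h) = (#|h| == i).
Proof.
rewrite /mechar mdeg_mesym1; case: eqP => //= _.
by apply/forallP=> k; rewrite mnmE leq_b1.
Qed.

Lemma multilinear_mesym1 n (m : 'X_{1..n}) :
  (forall k, m k <= 1)%N -> exists h : {set 'I_n}, m = mesym1 h.
Proof.
move=> m_le1; have: mechar (mdeg m) m by rewrite /mechar eqxx; apply/forallP.
by rewrite mecharP => /existsP[h /andP[/eqP-> _]]; exists h.
Qed.

(** Sets of equal size also have complements of equal size, so their indicator tuples contain each
    boolean equally often and are rearrangements of one another; the rearranging permutation is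
    [s]. *)
Lemma mesym1_perm n (h h' : {set 'I_n}) :
  #|h| = #|h'| -> exists s : 'S_n, mesym1 h = [multinom mesym1 h' (s i) | i < n].
Proof.
move=> eq_h; pose ind (A : {set 'I_n}) := [tuple k \in A | k < n].
have cntE (A : {set 'I_n}) (a : pred bool) :
    count a (ind A) = (a true * #|A| + a false * #|~: A|)%N.
  rewrite count_map -sum1_count big_enum_cond /= (bigID (mem A)) /=.
  rewrite -!sum1_card !big_distrr /=; congr (_ + _)%N.
    rewrite big_mkcondl /=; apply: eq_bigr => k kA.
    by rewrite kA; case: (a true).
  rewrite big_mkcondl /=; apply: eq_big => k; first by rewrite inE.
  by move=> /negbTE kA; rewrite kA; case: (a false).
have: perm_eq (ind h) (ind h').
  apply/seq.permP => a; rewrite !cntE eq_h; congr (_ + _ * _)%N.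
  by apply/eqP; rewrite -(eqn_add2l #|h|) cardsC eq_h cardsC.
case/tuple_permP => s /(congr1 (fun t => nth false t)) eq_s; exists s.
apply/mnmP => i; rewrite !mnmE.
have := congr1 (fun f => f (val i)) eq_s.
by rewrite -!tnth_nth !tnth_mktuple => ->.
Qed.

Lemma mcoeff_sym_mesym1 (R : nzRingType) n (p : {mpoly R[n]}) (h h' : {set 'I_n}) :
  p \is symmetric -> #|h| = #|h'| -> p@_(mesym1 h) = p@_(mesym1 h').
Proof.
move=> /issymP sym_p /mesym1_perm[s ->].
by rewrite -[in RHS](sym_p s) mcoeff_sym.
Qed.

Section ElementaryBasis.
Variable d : nat.
Implicit Types (p q : {mpoly rat[d]}) (h : {set 'I_d}).

(** The degree bound makes every monomial occurring in [p - q] squarefree, hence of the form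
    [mesym1 h]. *)
Lemma Lambda_ext p q : p \in @Lambda_pred d -> q \in @Lambda_pred d ->
  (forall h, p@_(mesym1 h) = q@_(mesym1 h)) -> p = q.
Proof.
move=> Lp Lq eq_pq; apply/eqP; rewrite -subr_eq0; apply/eqP/mpolyP => m.
have /andP[_ /degvarP deg_pq] := rpredB Lp Lq.
rewrite mcoeff0; apply/eqP; apply: contraT => nz.
have /multilinear_mesym1[h mE]: forall k, (m k <= 1)%N by move=> k; apply: deg_pq nz.
by move: nz; rewrite mE mcoeffB eq_pq subrr eqxx.
Qed.

Lemma mcoeff_mesym_mesym1 i h : (mesym d rat i)@_(mesym1 h) = (#|h| == i)%:R.
Proof. by rewrite mcoeff_mesym mechar_mesym1. Qed.

Lemma mesym1U1 h k : k \notin h -> (mesym1 h + U_(k))%MM = mesym1 (k |: h).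
Proof.
move=> kh; apply/mnmP => j; rewrite !mnmE in_setU1 eq_sym.
by case: eqVneq => [->|_]; rewrite ?(negbTE kh) ?addn0.
Qed.

Lemma mesym1D1 h k : k \in h -> (mesym1 h - U_(k))%MM = mesym1 (h :\ k).
Proof.
move=> kh; apply/mnmP => j; rewrite !mnmE in_setD1 eq_sym.
by case: eqVneq => [->|_]; rewrite ?kh ?subn0.
Qed.

(** * Lowering and raising elementary symmetric polynomials *)

Lemma pol_em_mesym i :
  pol_em (mesym d rat i.+1) = (d%:R - i%:R) *: mesym d rat i.
Proof.
apply: Lambda_ext => [||h]; first exact/pol_em_Lambda/mesym_Lambda.
  by rewrite rpredZ ?mesym_Lambda.
rewrite mcoeffZ mcoeff_mesym_mesym1 /pol_em raddf_sum (bigID (mem h)) /=.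
(* For [k] in [h], the term could only come from a monomial divisible by the square of x_k, and
   [mesym] has none. *)
rewrite big1 ?add0r => [|k kh]; last first.
  rewrite mcoeff_mderiv mcoeff_mesym /mechar [X in _ && X](_ : _ = false).
    by rewrite andbF mul0rn.
  by apply/forallP => /(_ k); rewrite mnmDE mnm1E eqxx mnmE kh.
(* Each of the [d - #|h|] indices outside [h] contributes the coefficient at [k |: h]. *)
transitivity (\sum_(k in ~: h) (#|h| == i)%:R : rat).
  apply: eq_big => [k|k kh]; first by rewrite inE.
  rewrite mcoeff_mderiv mesym1U1 // mcoeff_mesym_mesym1 cardsU1 kh add1n eqSS.
  by rewrite mnmE (negbTE kh).
rewrite sumr_const; case: eqP => [<-|_]; last by rewrite mul0rn mulr0.
have /(congr1 (fun n => n%:R : rat)) := cardsC h.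
by rewrite mulr1 card_ord natrD => <-; rewrite addrC addKr.
Qed.

Lemma pol_em_mesym0 : pol_em (mesym d rat 0) = 0.
Proof. by rewrite mesym0E /pol_em big1 // => k _; rewrite -mpolyC1 mderivC. Qed.

Lemma pol_ep_mesym i : pol_ep (mesym d rat i) = i.+1%:R *: mesym d rat i.+1.
Proof.
apply: Lambda_ext => [||h]; first exact/pol_ep_Lambda/mesym_Lambda.
  by rewrite rpredZ ?mesym_Lambda.
rewrite mcoeffZ mcoeff_mesym_mesym1 /pol_ep raddf_sum (bigID (mem h)) /=.
rewrite [X in _ + X]big1 ?addr0 => [|k kh]; last first.
  by rewrite expr2 -mulrA mcoeffD mcoeffN !mcoeffXUM mnmE (negbTE kh) oppr0 addr0.
transitivity (\sum_(k in h) (#|h| == i.+1)%:R : rat).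
  (* The part with x_k^2 cannot reach a squarefree monomial; multiplication by x_k contributes the
     coefficient at [h :\ k]. *)
  apply: eq_bigr => k kh.
  rewrite expr2 -mulrA mcoeffD mcoeffN !mcoeffXUM mnmE kh /= mesym1D1 //.
  rewrite mnmE in_setD1 eqxx /= oppr0 add0r mcoeff_mesym_mesym1.
  by rewrite (cardsD1 k h) kh add1n eqSS.
rewrite sumr_const; case: eqP => [->|_]; first by rewrite mulr1.
by rewrite mul0rn mulr0.
Qed.

(** * Expansion in elementary symmetric polynomials, with one chosen index set per degree *)

Definition initial (i : nat) : {set 'I_d} := [set k : 'I_d | k < i]%N.

Lemma card_initial i : (i <= d)%N -> #|initial i| = i.
Proof.
move=> le_id; rewrite -sum1dep_card -(big_ord_widen _ (fun=> 1%N)) //=.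
by rewrite sum1_card card_ord.
Qed.

Lemma Lambda_expansion p : p \in @Lambda_pred d ->
  p = \sum_(i < d.+1) p@_(mesym1 (initial i)) *: mesym d rat i.
Proof.
move=> Lp; apply: Lambda_ext => // [|h].
  by apply: rpred_sum => i _; rewrite rpredZ ?mesym_Lambda.
have lt_h : (#|h| < d.+1)%N by have := max_card h; rewrite card_ord ltnS.
(* Only the summand of index [#|h|] sees [mesym1 h], and symmetry of [p] moves [h] to the initial
   segment of that size. *)
rewrite raddf_sum (bigD1 (Ordinal lt_h)) //= big1 => [|i].
  rewrite addr0 mcoeffZ mcoeff_mesym_mesym1 eqxx mulr1.
  have /andP[symp _] := Lp.
  by apply: mcoeff_sym_mesym1; rewrite // card_initial.
rewrite -val_eqE /= eq_sym => /negbTE ne.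
by rewrite mcoeffZ mcoeff_mesym_mesym1 ne mulr0.
Qed.

(** * Normalization and the action on the w_i *)

Definition w_coef (i : nat) : rat := i`!%:R / \prod_(j < i) (d%:R - j%:R).

(** In this range [w_coef i] is the inverse of the binomial coefficient of d over i. *)
Lemma w_coef_neq0 i : (i <= d)%N -> w_coef i != 0.
Proof.
move=> le_id; rewrite mulf_neq0 ?pnatr_eq0 -?lt0n ?fact_gt0 //.
rewrite invr_neq0 //; apply/prodf_neq0 => j _.
by rewrite subr_eq0 eqr_nat gtn_eqF // (leq_trans (ltn_ord j)).
Qed.

(** This one recursion converts the structure constants of both e_- and e_+ on the e_i into those of
    V_d. *)
Lemma w_coefS i : (i < d)%N -> (d%:R - i%:R) * w_coef i.+1 = i.+1%:R * w_coef i.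
Proof.
move=> lt_id; have nz : d%:R - i%:R != 0 :> rat.
  by rewrite subr_eq0 eqr_nat gtn_eqF.
rewrite /w_coef big_ord_recr /= factS natrM invfM.
by rewrite mulrC -!mulrA mulVf // mulr1.
Qed.

Lemma Lambda_em_w (i j : 'I_d.+1) : i = j.+1 :> nat ->
  Lambda_em (Lambda_w i) = i%:R *: Lambda_w j.
Proof.
move=> eq_i; rewrite linearZ /= -!/(w_coef _) scalerA.
have ->: Lambda_em (Lambda_e d i) = (d%:R - j%:R) *: Lambda_e d j.
  by apply: val_inj; rewrite /= eq_i pol_em_mesym.
by rewrite scalerA mulrC eq_i w_coefS // -ltnS -eq_i.
Qed.

Lemma Lambda_em_w0 : Lambda_em (@Lambda_w d ord0) = 0.
Proof.
rewrite linearZ /= [Lambda_em _](_ : _ = 0) ?scaler0 //.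
by apply: val_inj; rewrite /= pol_em_mesym0.
Qed.

Lemma Lambda_ep_w (i : 'I_d.+1) (lt_id : (i.+1 < d.+1)%N) :
  Lambda_ep (Lambda_w i) = (d%:R - i%:R) *: Lambda_w (Ordinal lt_id).
Proof.
rewrite linearZ /= -!/(w_coef _) scalerA w_coefS //.
have ->: Lambda_ep (Lambda_e d i) = i.+1%:R *: Lambda_e d i.+1.
  by apply: val_inj; rewrite /= pol_ep_mesym.
by rewrite scalerA mulrC.
Qed.

Lemma Lambda_ep_wd : Lambda_ep (@Lambda_w d ord_max) = 0.
Proof.
rewrite linearZ /= [Lambda_ep _](_ : _ = 0) ?scaler0 //.
(* In d variables e_(d+1) vanishes. *)
by apply: val_inj; rewrite /= pol_ep_mesym mesym_geqnE ?scaler0.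
Qed.

(** * Coordinates, the basis property and the isomorphism *)

Definition w_coord (p : Lambda d) : 'rV[rat]_d.+1 :=
  \row_i ((Lambda_val p)@_(mesym1 (initial i)) / w_coef i).

Lemma w_coordK (p : Lambda d) :
  \sum_(i < d.+1) w_coord p 0 i *: Lambda_w i = p.
Proof.
apply: val_inj; rewrite raddf_sum /= [RHS](Lambda_expansion (valP p)).
apply: eq_bigr => i _; rewrite mxE linearZ /= -/(w_coef i) scalerA mulrC divfK //.
by rewrite w_coef_neq0 // -ltnS.
Qed.

(** The monomial of [initial i] has degree i, so among the e_j it occurs only in e_i. This yields
    both linear independence and injectivity of [w_map]. *)
Lemma w_coord_sum (c : 'I_d.+1 -> rat) i :
  w_coord (\sum_(i < d.+1) c i *: Lambda_w i) 0 i = c i.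
Proof.
rewrite mxE -[Lambda_val _]/(val _) !raddf_sum (bigD1 i) //=.
rewrite [X in _ + X]big1 => [|j].
  rewrite addr0 -/(w_coef i) !mcoeffZ mcoeff_mesym_mesym1 card_initial -1?ltnS //.
  by rewrite eqxx mulr1 mulfK // w_coef_neq0 // -ltnS.
rewrite -val_eqE /= eq_sym => /negbTE ne.
by rewrite !mcoeffZ mcoeff_mesym_mesym1 card_initial -1?ltnS // ne !mulr0.
Qed.

Lemma Lambda_w_basis : is_basis (@Lambda_w d).
Proof.
split=> [c c0 i|p]; last by exists (w_coord p 0); rewrite w_coordK.
by rewrite -(w_coord_sum c) c0 mxE mcoeff0 mul0r.
Qed.

Definition w_map (v : Vstd d) : Lambda d :=
  \sum_(i < d.+1) (v : 'rV[rat]_d.+1) 0 i *: Lambda_w i.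

Fact w_map_linear : linear w_map.
Proof.
move=> a u v; rewrite /w_map scaler_sumr -big_split /=.
by apply: eq_bigr => i _; rewrite !mxE scalerDl -scalerA.
Qed.
HB.instance Definition _ := GRing.isLinear.Build _ _ _ _ w_map w_map_linear.

Lemma w_map_v i : w_map (std_v i) = Lambda_w i.
Proof.
rewrite /w_map (bigD1 i) //= big1 => [|j /negbTE ne].
  by rewrite addr0 mxE !eqxx scale1r.
by rewrite mxE ne andbF scale0r.
Qed.

Lemma w_map_bij : bijective w_map.
Proof.
exists w_coord => [v|p]; last exact: w_coordK.
by apply/rowP => i; rewrite w_coord_sum.
Qed.

End ElementaryBasis.

Lemma Vstd_ext d (V : lmodType rat) (f g : {linear Vstd d -> V}) :
  (forall i, f (std_v i) = g (std_v i)) -> f =1 g.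
Proof.
move=> fg v; rewrite (row_sum_delta v) !linear_sum.
by apply: eq_bigr => i _; rewrite !linearZ -/(std_v i) fg.
Qed.

(** In both modules h is the commutator of e_+ and e_-, so a linear map commuting with these two
    commutes with h. *)
Lemma sl2_iso_ep_em (V W : sl2Module) (f : {linear V -> W}) :
  bijective f -> (forall v, f (sl2_ep v) = sl2_ep (f v)) ->
  (forall v, f (sl2_em v) = sl2_em (f v)) -> sl2_iso f.
Proof.
move=> bij_f f_ep f_em; split=> // v.
by rewrite -!sl2_rel_ep_em linearB /= !(f_ep, f_em).
Qed.

Theorem theorem6 (d : nat) (d_ge1 : (1 <= d)%N) :
  is_basis (@Lambda_w d) /\
  exists phi : {linear Vstd d -> Lambda d},
    (forall i : 'I_d.+1, phi (std_v i) = Lambda_w i) /\ sl2_iso phi.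
Proof.
split; first exact: Lambda_w_basis.
pose phi : {linear Vstd d -> Lambda d} := @w_map d.
exists phi; split; first exact: w_map_v.
apply: sl2_iso_ep_em; first exact: w_map_bij.
- apply: (@Vstd_ext _ _ (phi \o sl2_ep) (sl2_ep \o phi)) => i /=.
  rewrite w_map_v; have [lt_id|] := ltnP i.+1 d.+1.
    by rewrite (std_ep_v lt_id) (Lambda_ep_w lt_id) linearZ /= w_map_v.
  (* At the top index both sides are zero, in accordance with v_(d+1) = 0. *)
  rewrite ltnS => le_di; have -> : i = ord_max.
    by apply/val_inj/eqP; rewrite eqn_leq -ltnS ltn_ord.
  by rewrite std_ep_vd Lambda_ep_wd linear0.
- apply: (@Vstd_ext _ _ (phi \o sl2_em) (sl2_em \o phi)) => i /=.
  rewrite w_map_v; case: i => [[|i] lt_i].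
    rewrite (_ : Ordinal lt_i = ord0); last exact: val_inj.
    by rewrite std_em_v0 Lambda_em_w0 linear0.
  have eq_i : Ordinal lt_i = (Ordinal (ltnW lt_i)).+1 :> nat by [].
  by rewrite (std_em_v eq_i) (Lambda_em_w eq_i) linearZ /= w_map_v.
Qed.
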